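(* For every integer $d\ge 1$, the number of labeled floor diagrams of degree $d$ and genus $0$ is $d^{d-2}$.
   Context: Let $d>0$ and $g\ge 0$ be integers. A labeled floor diagram of degree $d$ and genus $g$ is a connected oriented graph $G=(V,E)$ on a linearly ordered $d$-element vertex set $V$ (taken to be $\{1,\dots,d\}$), together with a weight function $w:E\to\mathbb{Z}_{>0}$, such that: (Genus) $E$ consists of $d+g-1$ edges (equivalently, the first Betti number of the underlying unoriented graph is $g$); (Compatibility with the order) each edge is directed from a vertex $u$ to a vertex $v>u$ (so there are no loops; multiple edges are allowed); (Divergence) for each vertex $v$, the quantity $\operatorname{div}(v)$, defined as the sum of the weights of the edges directed away from $v$ minus the sum of the weights of the edges directed towards $v$, satisfies $\operatorname{div}(v)\le 1$. Diagrams are counted on the fixed vertex set $\{1,\dots,d\}$, up to isomorphisms of weighted oriented graphs that fix every vertex. *)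

(* Defs.v *)
From mathcomp Require Import all_boot all_order all_algebra.

Set Implicit Arguments.
Unset Strict Implicit.
Unset Printing Implicit Defensive.

(* Loops and multiple edges are allowed: edges are the elements of an arbitrary
   finite type, and two distinct ones may agree on all their data. *)
Record weighted_graph (d : nat) := WeightedGraph {
  edge : finType;
  src : edge -> 'I_d;
  tgt : edge -> 'I_d;
  weight : edge -> nat
}.

Definition adjacent (d : nat) (G : weighted_graph d) : rel 'I_d :=
  fun u v => [exists e : edge G, ((src e == u) && (tgt e == v))
                              || ((src e == v) && (tgt e == u))].

Definition connected_graph (d : nat) (G : weighted_graph d) : Prop :=
  forall u v : 'I_d, connect (adjacent G) u v.

Definition divergence (d : nat) (G : weighted_graph d) (v : 'I_d) : int :=
  (\sum_(e : edge G | src e == v) (weight e)%:Z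
   - \sum_(e : edge G | tgt e == v) (weight e)%:Z)%R.

(* The vertices 1, ..., d are represented by the elements 0, ..., d - 1 of 'I_d;
   the truncated subtraction is harmless since floor diagrams have d > 0. *)
Record floor_diagram (d g : nat) (G : weighted_graph d) : Prop := FloorDiagram {
  floor_connected : connected_graph G;
  floor_genus : #|edge G| = d + g - 1;
  floor_order : forall e : edge G, src e < tgt e;
  floor_weight : forall e : edge G, 0 < weight e;
  floor_divergence : forall v : 'I_d, (divergence G v <= 1)%R
}.

Definition isomorphic (d : nat) (G H : weighted_graph d) : Prop :=
  exists2 f : edge G -> edge H, bijective f &
    forall e : edge G, [/\ src (f e) = src e, tgt (f e) = tgt e
                         & weight (f e) = weight e].

(* P has exactly n elements up to R; meant for an equivalence relation R, in
   which case n is unique (see class_count_unique). *)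
Definition class_count (T : Type) (R : T -> T -> Prop) (P : T -> Prop)
    (n : nat) : Prop :=
  exists s : 'I_n -> T,
    [/\ forall i, P (s i),
        forall i j, R (s i) (s j) -> i = j
      & forall x, P x -> exists i, R x (s i)].

Definition number_of_floor_diagrams (d g n : nat) : Prop :=
  class_count (@isomorphic d) (@floor_diagram d g) n.

Lemma isomorphic_refl (d : nat) (G : weighted_graph d) : isomorphic G G.
Proof. by exists id; [exists id | ]. Qed.

Lemma isomorphic_sym (d : nat) (G H : weighted_graph d) :
  isomorphic G H -> isomorphic H G.
Proof.
case=> f [g fK gK] Hf; exists g; first by exists f.
by move=> e; have [] := Hf (g e); rewrite gK.
Qed.

Lemma isomorphic_trans (d : nat) (G H K : weighted_graph d) :
  isomorphic G H -> isomorphic H K -> isomorphic G K.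
Proof.
case=> f bf Hf [g bg Hg]; exists (g \o f); first exact: bij_comp.
by move=> e /=; have [-> -> ->] := Hg (f e); apply: Hf.
Qed.

Lemma class_count_unique (T : Type) (R : T -> T -> Prop) (P : T -> Prop) m n :
  (forall x y, R x y -> R y x) -> (forall x y z, R x y -> R y z -> R x z) ->
  class_count R P m -> class_count R P n -> m = n.
Proof.
move=> symR trR.
have le k l : class_count R P k -> class_count R P l -> k <= l.
  case=> s [Ps injs _] [t [_ _ surt]].
  have [f Hf] := fin_all_exists (fun i => surt _ (Ps i)).
  have injf : injective f.
    move=> i j eqf; apply: injs; apply: trR (Hf i) _.
    by apply: symR; rewrite eqf.
  by have := leq_card f injf; rewrite !card_ord.
by move=> cm cn; apply/eqP; rewrite eqn_leq !le.
Qed.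

(* Main.v *)
Require Import Defs.
From mathcomp Require Import all_boot all_algebra zify ring.

(** Let the vertices of a diagram arrive in increasing order, each with the
    edges that end at it.  A connected graph with d - 1 edges on d vertices has
    no cycle, so an arriving vertex receives at most one edge from each
    component of the forest built so far (if the sources hit fewer components
    than there are edges at some step, too many components are left at the end:
    [card_tops]).

    Call 1 - div(u) the capacity of u: it is the weight that u may still send.
    Divergences add up to 0 on a component, so the capacities in a component
    with s vertices add up to s ([spend_balanced]), and there are exactly s ways
    to choose the source and the weight of an edge from that component to the
    new vertex.  Hence a set A of components can be attached to the new vertex
    in as many ways as the product of their sizes ([card_admissible]), and only
    the sizes of the components matter in the sequel.

    If the forest on the first k vertices has m components of sizes
    s_1, ..., s_m, and if r = d - k vertices are still to come, the number of
    ways to complete it is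

                  s_1 ... s_m r^(m-1) d^(r-1)          ([card_completions]).

    In the induction on r, attaching the components in A to vertex k creates a
    component of size 1 + sum_A s_i, so the claim reduces to

      sum_A (1 + sum_A s_i) (r-1)^(m-|A|) = r^(m-1) (r + s_1 + ... + s_m)
                                          = r^(m-1) d,

    an instance of [sum_subsets].  For the empty forest the recursion gives
    d^(d-2).

    Isomorphism classes are coded by matrices: the entry (k, u) is the total
    weight of the edges from u to k.  The matrix is an isomorphism invariant
    ([bundle_iso]), the diagrams give exactly the matrices all of whose steps
    are admissible ([floor_graph_of], [floor_columns]), and a diagram is
    isomorphic to the graph read off its matrix since its edges are simple. *)

Set Implicit Arguments.
Unset Strict Implicit.
Unset Printing Implicit Defensive.

(** * Adding one vertex to a forest *)

(** The edges that end at a given vertex: [c u] is the weight of the one that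
    starts at [u], and 0 if there is none.  The values range over {0, ..., d}
    for d = n + 1, since no weight exceeds d (see [bundle_le]). *)
Definition column n := {ffun 'I_n.+1 -> 'I_n.+2}.
Definition supp n (c : column n) : {set 'I_n.+1} := [set u | (c u : nat) != 0].

(** A forest is given by the map [p] that sends each vertex to the largest
    vertex of its component, and by the capacities [a u] = 1 - div(u).  [join]
    and [spend] are the effect on them of adding the edges [c] that end at [k];
    a vertex that has not arrived yet is an isolated point of capacity 1. *)
Definition join n (k : 'I_n.+1) (c : column n) (p : 'I_n.+1 -> 'I_n.+1) u :=
  if p u \in k |: p @: supp c then k else p u.

Definition spend n (k : 'I_n.+1) (c : column n) (a : 'I_n.+1 -> nat) u :=
  if u == k then 1 + \sum_v c v else a u - c u.

(** The last condition says that distinct edges come from distinct components,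
    so that no cycle is created. *)
Definition admissible n (k : 'I_n.+1) (p : 'I_n.+1 -> 'I_n.+1) a (c : column n) :=
  [&& [forall u, c u <= a u], supp c \subset [set u : 'I_n.+1 | u < k]
    & #|p @: supp c| == #|supp c|].

Definition component n (p : 'I_n.+1 -> 'I_n.+1) x := [set u | p u == x].
Definition tops n k (p : 'I_n.+1 -> 'I_n.+1) :=
  [set x : 'I_n.+1 | (x < k) && (p x == x)].

(** [p] describes components of a graph on the vertices below [k], each
    represented by its largest vertex. *)
Record reps n (k : nat) (p : 'I_n.+1 -> 'I_n.+1) : Prop := Reps {
  reps_idem : forall u, p (p u) = p u;
  reps_old : forall u : 'I_n.+1, u < k -> p u < k;
  reps_new : forall u : 'I_n.+1, k <= u -> p u = u
}.

(** The divergences add up to 0 on each component. *)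
Definition balanced n (p : 'I_n.+1 -> 'I_n.+1) (a : 'I_n.+1 -> nat) :=
  forall x, \sum_(u in component p x) a u = #|component p x|.

Lemma touched_tops n (k : 'I_n.+1) p (c : column n) :
  reps k p -> supp c \subset [set u : 'I_n.+1 | u < k] ->
  p @: supp c \subset tops k p.
Proof.
move=> rp /subsetP sc; apply/subsetP=> _ /imsetP[u /sc + ->].
by rewrite !inE (reps_idem rp) eqxx andbT => /(reps_old rp).
Qed.

Lemma new_untouched n (k : 'I_n.+1) p (A : {set 'I_n.+1}) :
  A \subset tops k p -> k \notin A.
Proof. by move/subsetP=> sA; apply/negP=> /sA; rewrite inE ltnn. Qed.

Lemma join_reps n (k : 'I_n.+1) p (c : column n) :
  reps k p -> supp c \subset [set u : 'I_n.+1 | u < k] ->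
  reps k.+1 (join k c p).
Proof.
move=> rp sc; have sR := touched_tops rp sc.
have pk : p k = k by apply: (reps_new rp).
split=> [u | u | u ltku]; rewrite /join.
- case pu: (p u \in k |: p @: supp c); first by rewrite pk setU11.
  by rewrite (reps_idem rp) pu.
- rewrite ltnS leq_eqVlt => /orP[/eqP/val_inj-> | ltuk].
    by rewrite pk setU11.
  by case: ifP => // _; rewrite ltnS ltnW ?(reps_old rp).
- rewrite (reps_new rp) ?(ltnW ltku) //; case: ifP => //.
  rewrite in_setU1 => /orP[/eqP-> // | /(subsetP sR)].
  by rewrite inE ltnNge ltnW.
Qed.

Lemma component_join_new n (k : 'I_n.+1) p (c : column n) :
  component (join k c p) k = component p k :|: \bigcup_(x in p @: supp c) component p x.
Proof.
apply/setP=> u; rewrite !inE /join in_setU1.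
apply/idP/orP => [|[/eqP->|/bigcupP[x xA]]]; last 2 first.
- by rewrite eqxx eqxx.
- by rewrite inE => /eqP->; rewrite xA orbT eqxx.
case: ifP => [/orP[-> _ | pA _] | /norP[/negPf-> _] //]; first by left.
by right; apply/bigcupP; exists (p u); rewrite ?inE.
Qed.

Lemma component_join_other n (k : 'I_n.+1) p (c : column n) x :
  x \notin k |: p @: supp c -> component (join k c p) x = component p x.
Proof.
move=> xA; apply/setP=> u; rewrite !inE /join; case: ifP => // puA.
by apply/eqP/eqP=> def; [rewrite -def setU11 in xA | rewrite -def puA in xA].
Qed.

Lemma component_join_touched n (k : 'I_n.+1) p (c : column n) x :
  k \notin p @: supp c -> x \in p @: supp c -> component (join k c p) x = set0.
Proof.
move=> kA xA; apply/setP=> u; rewrite !inE /join; case: ifP => [_|puA].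
  by apply/negP=> /eqP def; rewrite def xA in kA.
by apply/negP=> /eqP def; rewrite def in_setU1 xA orbT in puA.
Qed.

Lemma component_new n (k : 'I_n.+1) p : reps k p -> component p k = [set k].
Proof.
move=> rp; apply/setP=> u; rewrite !inE.
case: (ltnP u k) => [ltuk | leku]; last by rewrite (reps_new rp).
have := reps_old rp ltuk; rewrite ltn_neqAle => /andP[/negPf H _].
rewrite -val_eqE /= H; symmetry; apply/negbTE; rewrite -val_eqE neq_ltn ltuk //.
Qed.

Lemma sum_component_join_new n (k : 'I_n.+1) p (c : column n) (F : 'I_n.+1 -> nat) :
  reps k p -> supp c \subset [set u : 'I_n.+1 | u < k] ->
  \sum_(u in component (join k c p) k) F u =
  F k + \sum_(x in p @: supp c) \sum_(u in component p x) F u.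
Proof.
move=> rp sc; have kA := new_untouched (touched_tops rp sc).
rewrite component_join_new component_new // big_setU1; last first.
  apply/bigcupP=> -[x xA]; rewrite inE (reps_new rp) // => /eqP def.
  by rewrite def xA in kA.
congr (_ + _); rewrite (partition_big p (mem (p @: supp c))) /=; last first.
  by move=> u /bigcupP[x xA]; rewrite inE => /eqP->.
apply: eq_bigr => x xA; apply: eq_bigl => u; rewrite [in RHS]inE.
apply: andb_idl => /eqP pu; apply/bigcupP; exists x => //.
by rewrite inE pu.
Qed.

Lemma card_component_join_new n (k : 'I_n.+1) p (c : column n) :
  reps k p -> supp c \subset [set u : 'I_n.+1 | u < k] ->
  #|component (join k c p) k| = 1 + \sum_(x in p @: supp c) #|component p x|.
Proof.
move=> rp sc; rewrite -sum1_card sum_component_join_new //.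
by congr (_ + _); apply: eq_bigr => x _; rewrite sum1_card.
Qed.

(** The components touched by [c] lose the total weight of [c], vertex [k] gains
    it, and [k] brings a capacity of 1 of its own. *)
Lemma spend_balanced n (k : 'I_n.+1) p a (c : column n) :
  reps k p -> balanced p a -> admissible k p a c ->
  balanced (join k c p) (spend k c a).
Proof.
move=> rp ba /and3P[/forallP ca sc _] x.
have sR := touched_tops rp sc; have kA := new_untouched sR.
have other y : y \notin k |: p @: supp c ->
    \sum_(u in component p y) spend k c a u = #|component p y|.
  move=> yA; rewrite -ba; apply: eq_bigr => u; rewrite inE => /eqP puy.
  rewrite /spend; case: eqP => [def | _].
    by rewrite -puy def (reps_new rp) // setU11 in yA.
  have [uc | ] := boolP (u \in supp c); last first.
    by rewrite inE negbK => /eqP->; rewrite subn0.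
  by rewrite -puy in_setU1 imset_f ?orbT in yA.
have [xA | xnA] := boolP (x \in k |: p @: supp c); last first.
  by rewrite component_join_other // other.
have [-> | nxk] := eqVneq x k; last first.
  rewrite in_setU1 (negPf nxk) /= in xA.
  by rewrite component_join_touched // big_set0 cards0.
rewrite sum_component_join_new // card_component_join_new // /spend eqxx -addnA.
congr (_ + _); under [in RHS]eq_bigr => y _ do rewrite -ba.
have -> : \sum_v c v = \sum_(y in p @: supp c) \sum_(u in component p y) c u.
  rewrite (bigID (fun u => p u \in p @: supp c)) /= [X in _ + X]big1 ?addn0.
    rewrite (partition_big p (mem (p @: supp c))) //=.
    apply: eq_bigr => y yA; apply: eq_bigl => u; rewrite inE.
    by apply: andb_idl => /eqP->.
  move=> u puA; apply/eqP; rewrite -[_ == _]negbK; apply/negP => cu.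
  by case/negP: puA; apply: imset_f; rewrite inE.
rewrite -big_split /=; apply: eq_bigr => y yA; rewrite -big_split /=.
apply: eq_bigr => u; rewrite inE => /eqP pu; case: eqP => [def | _].
  by rewrite -pu def (reps_new rp) // (negPf kA) in yA.
by rewrite subnKC.
Qed.

Lemma tops_join n (k : 'I_n.+1) p (c : column n) :
  reps k p -> supp c \subset [set u : 'I_n.+1 | u < k] ->
  tops k.+1 (join k c p) = k |: (tops k p :\: p @: supp c).
Proof.
move=> rp sc; have kA := new_untouched (touched_tops rp sc).
have pk : p k = k by apply: (reps_new rp).
apply/setP=> x; rewrite in_setU1 in_setD !inE /join in_setU1.
have [-> | nxk] := eqVneq x k; first by rewrite pk eqxx ltnS leqnn eqxx.
have neq : (x : nat) != k by rewrite val_eqE.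
rewrite ltnS leq_eqVlt (negPf neq) /=.
have [ltxk | _] := ltnP; last by rewrite andbF.
have npxk : p x != k by rewrite -val_eqE neq_ltn (reps_old rp).
rewrite (negPf npxk) /=; have [pxA | pxA] := boolP (p x \in _).
  rewrite eq_sym (negPf nxk); symmetry; apply/negbTE/negP=> /andP[xA /eqP def].
  by rewrite -def pxA in xA.
by rewrite andbC; symmetry; apply: andb_idr => /eqP <-.
Qed.

(** The columns that touch exactly the components in [A] correspond to the
    choices, for each of them, of a pair (source [u], weight [w]) with
    0 < [w] <= [a u]; since the capacities are balanced, there are as many such
    pairs as vertices in the component. *)
Lemma card_admissible n (k : 'I_n.+1) p a (A : {set 'I_n.+1}) :
  reps k p -> balanced p a -> A \subset tops k p ->
  #|[set c | admissible k p a c & p @: supp c == A]|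
  = \prod_(x in A) #|component p x|.
Proof.
move=> rp ba sA.
pose y0 : 'I_n.+1 * 'I_n.+2 := (ord0, ord0).
pose F x := [pred uw : 'I_n.+1 * 'I_n.+2 | (p uw.1 == x) && (0 < uw.2 <= a uw.1)].
have le_a u : a u <= n.+1.
  apply: (@leq_trans #|component p (p u)|).
    by rewrite -ba (bigD1 u) ?inE //= leq_addr.
  by rewrite (leq_trans (max_card _)) ?card_ord.
have cardF x : #|F x| = #|component p x|.
  rewrite -ba -sum1_card.
  rewrite (partition_big fst (mem (component p x))) /=; last first.
    by move=> uw /andP[/eqP def _]; rewrite inE def.
  apply: eq_bigr => u; rewrite inE => /eqP pu.
  rewrite (reindex_onto (pair u) snd) /=; last by case=> ? ? /andP[_ /eqP<-].
  rewrite sum1_card -[RHS](@card_ord (a u)).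
  have inordS (i : 'I_(a u)) : (inord i.+1 : 'I_n.+2) = i.+1 :> nat.
    by rewrite inordK // ltnS (leq_trans (ltn_ord i)).
  have inj : injective (fun i : 'I_(a u) => inord i.+1 : 'I_n.+2).
    by move=> i j /(congr1 val) /=; rewrite !inordS => -[/val_inj].
  rewrite -(card_codom inj); apply: eq_card => w; rewrite unfold_in /= inE /= pu.
  rewrite !eqxx !andbT /=.
  apply/andP/codomP => [[w0 wa] | [i ->]]; last first.
    by rewrite inordS ltn_ord.
  have lt : w.-1 < a u by lia.
  by exists (Ordinal lt); apply: val_inj; rewrite /= prednK // inord_val.
(* The column given by the choice of a pair [g x] for each [x] in [A]. *)
pose col (g : {ffun 'I_n.+1 -> 'I_n.+1 * 'I_n.+2}) : column n :=
  [ffun u => if (p u \in A) && ((g (p u)).1 == u) then (g (p u)).2 else ord0].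
have colP g u : g \in pfamily y0 A F -> col g u != 0 :> nat ->
    [/\ p u \in A, (g (p u)).1 = u & (g (p u)).2 = col g u].
  by move=> _; rewrite ffunE; case: ifP => // /andP[? /eqP].
have gP g x : g \in pfamily y0 A F -> x \in A ->
    [/\ p (g x).1 = x, col g (g x).1 = (g x).2, ((g x).2 : nat) != 0
      & (g x).2 <= a (g x).1].
  move=> /pfamilyP[_ gA] xA; have := gA x xA.
  rewrite inE => /andP[/eqP px /andP[g0 ga]].
  by split; rewrite ?ffunE ?px ?xA ?eqxx // -lt0n.
have suppE g : g \in pfamily y0 A F -> supp (col g) = [set (g x).1 | x in A].
  move=> gF; apply/setP=> u; rewrite inE; apply/idP/imsetP => [cu | [x xA ->]].
    by have [puA gu _] := colP _ _ gF cu; exists (p u).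
  by have [_ -> ] := gP _ _ gF xA.
have tE g : g \in pfamily y0 A F -> p @: supp (col g) = A.
  move=> gF; rewrite suppE // -imset_comp -[RHS]imset_id.
  by apply: eq_in_imset => x xA /=; have [] := gP _ _ gF xA.
have -> : \prod_(x in A) #|component p x| = #|pfamily y0 A F|.
  rewrite card_pfamily foldrE big_image; apply: eq_bigr => x _.
  by rewrite -cardF.
rewrite -[RHS](card_in_imset (f := col)); last first.
  move=> g h gF hF eqgh; apply/ffunP=> x.
  have [xA | xA] := boolP (x \in A); last first.
    have out f : f \in pfamily y0 A F -> f x = y0.
      case/pfamilyP=> /subsetP/(_ x) sf _; apply/eqP.
      by apply: contraNT xA => /sf.
    by rewrite !out.
  have [pg cg g0 _] := gP _ _ gF xA.
  have hg0 : col h (g x).1 != 0 :> nat by rewrite -eqgh cg.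
  have [_] := colP _ _ hF hg0; rewrite pg => h1 h2.
  by apply/eqP; rewrite -pair_eqE /= h1 h2 -eqgh cg !eqxx.
apply: eq_card => c; rewrite inE; apply/andP/imsetP => [[] | [g gF ->]]; last first.
  split; last by rewrite tE.
  apply/and3P; split.
  - apply/forallP=> u; have [-> // | cu] := eqVneq (col g u : nat) 0.
    have [puA gu gc] := colP _ _ gF cu.
    by have [_ _ _] := gP _ _ gF puA; rewrite gu gc.
  - apply/subsetP=> u; rewrite suppE // => /imsetP[x xA ->]; rewrite inE ltnNge.
    have [pg _ _ _] := gP _ _ gF xA; apply/negP => le.
    have := subsetP sA _ xA; rewrite inE -pg (reps_idem rp) (reps_new rp) //.
    by rewrite ltnNge le.
  - by rewrite tE // suppE // card_in_imset // => x y xA yA /(congr1 p);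
      have [-> _ _ _] := gP _ _ gF xA; have [-> _ _ _] := gP _ _ gF yA.
move=> /and3P[/forallP ca sc /imset_injP inj] /eqP tA.
pose g := [ffun x => if [pick u in supp c | p u == x] is Some u
                     then (u, c u) else y0].
have gE u : u \in supp c -> g (p u) = (u, c u).
  move=> uc; rewrite ffunE; case: pickP => [v /andP[vc /eqP /inj-> //]|/(_ u)].
  by rewrite uc eqxx.
exists g; last first.
  apply/ffunP=> u; rewrite ffunE; have [uc | uc] := boolP (u \in supp c).
    by rewrite gE //= eqxx -tA imset_f.
  have cu : c u = ord0 by apply/val_inj/eqP; rewrite inE negbK in uc.
  case: ifP => // /andP[]; rewrite -tA => /imsetP[v vc ->].
  by rewrite gE //= => /eqP->.
apply/pfamilyP; split=> [|x]; last first.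
  rewrite -tA => /imsetP[u uc ->]; rewrite gE // inE /= eqxx ca andbT lt0n.
  by rewrite inE in uc.
apply/subsetP=> x; rewrite inE ffunE; case: pickP => [u /andP[uc /eqP <-] _|_].
  by rewrite -tA imset_f.
by rewrite eqxx.
Qed.

(** * Counting the completions of a forest *)
Lemma sum_subsets_setU1 (T : finType) (x : T) (R : {set T}) (F : {set T} -> nat) :
  x \notin R ->
  \sum_(A : {set T} | A \subset x |: R) F A =
  \sum_(A : {set T} | A \subset R) F A
  + \sum_(A : {set T} | A \subset R) F (x |: A).
Proof.
move=> xR; rewrite (bigID (fun A : {set T} => x \in A)) /= addnC; congr (_ + _).
  by apply: eq_bigl => A; rewrite -subsetD1 setU1K.
rewrite (reindex_onto (fun A => x |: A) (fun A => A :\ x)) /=; last first.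
  by move=> A /andP[_ xA]; rewrite setD1K.
apply: eq_bigl => A; rewrite setU11 andbT.
apply/andP/idP => [[sA /eqP def] | sA].
  by rewrite -(setU1K xR) -def setSD.
by rewrite setUS // setU1K ?eqxx //; apply: contra xR => /(subsetP sA).
Qed.

(** The parameter [z] makes the induction work: when a new element x is added to
    R, the subsets that contain x contribute the same sum with [z + s x] in
    place of [z], and the other ones are multiplied by [q]. *)
Lemma sum_subsets (T : finType) (R : {set T}) (s : T -> nat) (q z : nat) :
  q.+1 * \sum_(A : {set T} | A \subset R)
           (z + \sum_(x in A) s x) * q ^ (#|R| - #|A|)
  = q.+1 ^ #|R| * (q.+1 * z + \sum_(x in R) s x).
Proof.
elim: {R}#|R| {-2}R (erefl #|R|) z => [|m IH] R cR z.
  have -> : R = set0 by apply/eqP; rewrite -cards_eq0 cR.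
  rewrite (big_pred1 set0) => [|A]; last by rewrite subset0.
  by rewrite !big_set0 cards0 !addn0 !expn0 mul1n muln1.
have /card_gt0P[x xR] : 0 < #|R| by rewrite cR.
have xR' : x \notin R :\ x by rewrite !inE eqxx.
have cR' : #|R :\ x| = m by move: cR; rewrite (cardsD1 x) xR => -[].
have xA (A : {set T}) : A \subset R :\ x -> x \notin A.
  by move=> sA; apply: contra xR' => /(subsetP sA).
rewrite cR -[in LHS](setD1K xR) sum_subsets_setU1 // [in RHS](big_setD1 x) //=.
rewrite (eq_bigr (fun A : {set T} =>
           q * ((z + \sum_(y in A) s y) * q ^ (m - #|A|)))); last first.
  move=> A sA; rewrite subSn; last by rewrite -cR' subset_leq_card.
  by rewrite expnS mulnCA.
rewrite [X in _ + X](eq_bigr (fun A : {set T} =>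
           (z + s x + \sum_(y in A) s y) * q ^ (m - #|A|))); last first.
  by move=> A /xA xnA; rewrite big_setU1 // cardsU1 xnA addnA subSS.
rewrite -cR' in IH *; rewrite -big_distrr mulnDr /= mulnCA !IH // expnS.
by ring.
Qed.

Lemma card_tuple_cons (T : finType) r (P : pred (seq T)) :
  #|[set t : r.+1.-tuple T | P t]| =
  \sum_(c : T) #|[set t : r.-tuple T | P (c :: t)]|.
Proof.
rewrite -sum1_card (partition_big (@thead _ T) predT) //=.
apply: eq_bigr => c _; rewrite -sum1_card.
rewrite (reindex_onto (fun t : r.-tuple T => [tuple of c :: t])
                      (fun t => [tuple of behead t])) /=.
  apply: eq_bigl => t; rewrite !inE theadE eqxx andbT.
  by rewrite (_ : [tuple of _] = t) ?eqxx ?andbT //; apply: val_inj.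
by move=> t /andP[_ /eqP <-]; rewrite -tuple_eta.
Qed.

(** The components with a vertex below [k] partition the vertices below [k]. *)
Lemma sum_card_component n k (p : 'I_n.+1 -> 'I_n.+1) :
  k <= n.+1 -> reps k p -> \sum_(x in tops k p) #|component p x| = k.
Proof.
move=> lekn rp; transitivity (\sum_(u < n.+1 | u < k) 1); last first.
  by rewrite -(big_ord_widen n.+1 (fun=> 1) lekn) sum1_card card_ord.
rewrite [RHS](partition_big p (mem (tops k p))) /=; last first.
  by move=> u ltuk; rewrite inE (reps_old rp) // (reps_idem rp) eqxx.
apply: eq_bigr => x; rewrite inE => /andP[ltxk _]; rewrite -sum1_card.
apply: eq_bigl => u; rewrite inE; symmetry; apply: andb_idl => /eqP pu.
by case: (ltnP u k) => // leku; move: ltxk;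
  rewrite -pu (reps_new rp) // ltnNge leku.
Qed.

(** [s] lists the columns of the vertices k, k + 1, ...; the final test is that
    a single component is left. *)
Fixpoint completes n k p a (s : seq (column n)) : bool :=
  if s is c :: s' then
    admissible (inord k) p a c
    && completes k.+1 (join (inord k) c p) (spend (inord k) c a) s'
  else #|tops n.+1 p| == 1.

Definition completions n r k p a :=
  #|[set t : r.-tuple (column n) | completes k p a t]|.

(** The columns of vertex [k] are grouped by the set [A] of components that they
    touch.  The factor [q.+1] replaces a division, so that the case [k] = 0,
    where there is no component yet, is covered too. *)
Lemma completions_step n q k p a :
  k + q = n -> reps k p -> balanced p a ->
  (forall p' a', reps k.+1 p' -> balanced p' a' ->
    @completions n q k.+1 p' a' * n.+1 =
    (\prod_(x in tops k.+1 p') #|component p' x|)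
    * q ^ #|tops k.+1 p'|.-1 * n.+1 ^ q) ->
  q.+1 * (@completions n q.+1 k p a * n.+1) =
  (\prod_(x in tops k p) #|component p x|) * q.+1 ^ #|tops k p| * n.+1 ^ q.+1.
Proof.
move=> dn rp ba IH; have ltkn : k < n.+1 by rewrite ltnS -dn leq_addr.
have kE : (inord k : 'I_n.+1) = k :> nat by rewrite inordK.
have rp' : reps (inord k : 'I_n.+1) p by rewrite kE.
set R := tops k p; have RE : R = tops (inord k : 'I_n.+1) p by rewrite kE.
rewrite /completions card_tuple_cons /= (bigID (admissible (inord k) p a)) /=.
rewrite [X in _ + X]big1 ?addn0; last first.
  move=> c /negPf ->; apply/eqP; rewrite cards_eq0.
  by apply/eqP/setP=> t; rewrite !inE.
rewrite big_distrl /=.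
(* [f A] is the factor by which the completions depend on the new component. *)
pose f (A : {set 'I_n.+1}) :=
  (1 + \sum_(x in A) #|component p x|) * q ^ (#|R| - #|A|).
rewrite (eq_bigr (fun c => (\prod_(x in R :\: p @: supp c) #|component p x|)
    * f (p @: supp c) * n.+1 ^ q)); last first.
  move=> c ac; have [/and3P[_ sc _]] := (ac).
  have rpj := join_reps rp' sc; rewrite kE in rpj.
  have sA := touched_tops rp' sc; have kA := new_untouched sA.
  under eq_finset => t do rewrite ac.
  rewrite -/(completions _ _ _ _) IH //; last exact: spend_balanced.
  have rj := tops_join rp' sc; rewrite kE -/R in rj; rewrite rj.
  have knR : inord k \notin R :\: p @: supp c by rewrite !inE kE ltnn andbF.
  rewrite big_setU1 //= card_component_join_new // cardsU1 knR /= cardsDS ?RE //.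
  rewrite -RE /f; congr (_ * _); rewrite [RHS]mulnCA -mulnA.
  congr (_ * (_ * _)); apply: eq_bigr => x xR; rewrite component_join_other //.
  rewrite in_setU1 negb_or; move: (xR); rewrite in_setD => /andP[-> _].
  by rewrite andbT; apply: contraNneq knR => <-.
rewrite (partition_big (fun c => p @: supp c) (fun A => A \subset R)) /=; last first.
  by move=> c /and3P[_ sc _]; rewrite RE touched_tops.
rewrite (eq_bigr (fun A => (\prod_(x in R) #|component p x|) * n.+1 ^ q * f A));
    last first.
  move=> A sA; rewrite (eq_bigr (fun=>
      (\prod_(x in R :\: A) #|component p x|) * f A * n.+1 ^ q));
    last first.
    by move=> c /andP[_ /eqP->].
  rewrite (eq_bigl (mem [set c | admissible (inord k) p a c & p @: supp c == A])).
    rewrite sum_nat_const card_admissible -?RE //.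
    by rewrite [in RHS](big_setID A) /= (setIidPr sA); ring.
  by move=> c; rewrite !inE.
rewrite -big_distrr /= mulnCA sum_subsets sum_card_component //.
  have -> : q.+1 * 1 + k = n.+1 by rewrite muln1 addSn addnC dn.
  by rewrite expnS; ring.
by rewrite -dn leqW ?leq_addr.
Qed.

Lemma tops_gt0 n k (p : 'I_n.+1 -> 'I_n.+1) :
  0 < k -> reps k p -> 0 < #|tops k p|.
Proof.
move=> k_gt0 rp; apply/card_gt0P; exists (p ord0).
by rewrite inE (reps_idem rp) eqxx (reps_old rp).
Qed.

(** The closed formula for the number of completions, multiplied by d = n + 1 to
    avoid a negative exponent when [q] = 0.  It needs at least one component,
    whence [0 < k]. *)
Lemma card_completions n q k p a :
  0 < k -> k + q = n.+1 -> reps k p -> balanced p a ->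
  @completions n q k p a * n.+1 =
  (\prod_(x in tops k p) #|component p x|) * q ^ #|tops k p|.-1 * n.+1 ^ q.
Proof.
elim: q k p a => [|q IH] k p a k_gt0 dn rp ba; have R_gt0 := tops_gt0 k_gt0 rp.
  rewrite addn0 in dn; rewrite dn in rp R_gt0 *; rewrite muln1.
  have sumE := sum_card_component (leqnn _) rp.
  have -> : completions 0 n.+1 p a = (#|tops n.+1 p| == 1).
    have nilE (t : 0.-tuple (column n)) :
        completes n.+1 p a t = (#|tops n.+1 p| == 1).
      by rewrite (tuple0 t).
    rewrite /completions (eq_finset _ nilE); case: eqP => _; last first.
      by apply/eqP; rewrite cards_eq0; apply/eqP/setP=> t; rewrite !inE.
    by rewrite cardsT card_tuple.
  case: eqP => [/eqP/cards1P[x Rx] | nR1].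
    by rewrite Rx big_set1 cards1 muln1 mul1n; rewrite Rx big_set1 in sumE.
  by rewrite exp0n ?muln0 //; lia.
have kq : k + q = n by lia.
have step := completions_step kq rp ba.
apply/eqP; rewrite -(@eqn_pmul2l q.+1) // step; last first.
  by move=> p' a' rp' ba'; apply: IH => //; lia.
by rewrite -[in X in X == _](prednK R_gt0) expnS; apply/eqP; ring.
Qed.

(** The formula for [k] = 0 is one more step, from the empty forest. *)
Lemma card_all_completions n :
  @completions n n.+1 0 id (fun=> 1) = n.+1 ^ (n.+1 - 2).
Proof.
have rp : reps 0 (@id 'I_n.+1) by [].
have ba : balanced (@id 'I_n.+1) (fun=> 1) by move=> x; rewrite sum1_card.
have := completions_step (add0n n) rp ba.
have -> : tops 0 id = set0 :> {set 'I_n.+1} by apply/setP=> x; rewrite !inE.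
rewrite big_set0 cards0 => step; apply/eqP.
rewrite -(@eqn_pmul2r n.+1) // -(@eqn_pmul2l n.+1) // step; last first.
  by move=> p' a' rp' ba'; apply: card_completions.
case: n {rp ba step} => [|n] //.
by rewrite subSS subn1 /= !expnS; apply/eqP; ring.
Qed.

(** * Matrices whose steps are all admissible *)
Definition ordered n (W : 'I_n.+1 -> column n) :=
  forall k, supp (W k) \subset [set u : 'I_n.+1 | u < k].

(** The components and the capacities just before vertex [k] arrives, for the
    graph whose edges that end at vertex j are given by [W j]. *)
Fixpoint run_rep n (W : 'I_n.+1 -> column n) k : 'I_n.+1 -> 'I_n.+1 :=
  if k is k'.+1 then join (inord k') (W (inord k')) (run_rep W k') else id.

Fixpoint run_cap n (W : 'I_n.+1 -> column n) k : 'I_n.+1 -> nat :=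
  if k is k'.+1 then spend (inord k') (W (inord k')) (run_cap W k')
  else fun=> 1.

Definition valid n (W : 'I_n.+1 -> column n) :=
  [forall k : 'I_n.+1, admissible k (run_rep W k) (run_cap W k) (W k)]
  && (#|tops n.+1 (run_rep W n.+1)| == 1).

Lemma completes_run n (W : 'I_n.+1 -> column n) k r :
  completes k (run_rep W k) (run_cap W k) [seq W (inord i) | i <- iota k r] =
  all (fun i => admissible (inord i) (run_rep W i) (run_cap W i) (W (inord i)))
      (iota k r)
  && (#|tops n.+1 (run_rep W (k + r))| == 1).
Proof.
elim: r k => [|r IH] k /=; first by rewrite addn0.
by rewrite -andbA addnS -addSn -IH.
Qed.

Lemma completesE n (t : n.+1.-tuple (column n)) :
  completes 0 id (fun=> 1) t = valid (tnth t).
Proof.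
have -> : t = [seq tnth t (inord i) | i <- iota 0 n.+1] :> seq _.
  apply: (@eq_from_nth _ [ffun=> ord0]);
    first by rewrite size_map size_iota size_tuple.
  move=> i; rewrite size_tuple => lti; rewrite (nth_map 0) ?size_iota //.
  by rewrite nth_iota // (tnth_nth [ffun=> ord0]) inordK.
rewrite (completes_run (tnth t) 0 n.+1); congr (_ && _).
apply/allP/forallP => H k.
  by have := H k; rewrite mem_iota inord_val; apply; rewrite /= add0n.
rewrite mem_iota add0n => /= ltkn; have := H (inord k).
by rewrite inordK.
Qed.

Lemma ordered_valid n (W : 'I_n.+1 -> column n) : valid W -> ordered W.
Proof. by case/andP=> /forallP H _ k; have /and3P[] := H k. Qed.

Lemma ordered0 n (W : 'I_n.+1 -> column n) (k u : 'I_n.+1) :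
  ordered W -> k <= u -> W k u = 0 :> nat.
Proof.
move=> oW leku; apply/eqP; apply: contraLR leku => cu.
by rewrite -ltnNge; have /subsetP/(_ u) := oW k; rewrite !inE; apply.
Qed.

Lemma run_reps n (W : 'I_n.+1 -> column n) k :
  ordered W -> k <= n.+1 -> reps k (run_rep W k).
Proof.
move=> oW; elim: k => [|k IH] ltkn //=.
have kE : (inord k : 'I_n.+1) = k :> nat by rewrite inordK.
have := @join_reps n (inord k) (run_rep W k) (W (inord k)).
by move=> /(_ _ (oW _)); rewrite kE; apply; apply: IH; apply: ltnW.
Qed.

Lemma big_below_S n k (F : 'I_n.+1 -> nat) :
  k < n.+1 ->
  \sum_(j < n.+1 | j < k.+1) F j = \sum_(j < n.+1 | j < k) F j + F (inord k).
Proof.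
move=> ltkn; rewrite (bigD1 (inord k)) ?inordK //= addnC; congr (_ + _).
by apply: eq_bigl => j; rewrite -val_eqE /= inordK // ltnS ltn_neqAle andbC.
Qed.

(** The capacity of [u] is 1 before [u] arrives; then it grows by the incoming
    weight of [u], and each later column takes away from it.  The truncated
    subtraction is exact only if the successive columns respect capacities,
    but the formula holds anyway as both sides are truncated. *)
Lemma run_capE n (W : 'I_n.+1 -> column n) k u :
  ordered W -> k <= n.+1 ->
  run_cap W k u =
  1 + (if u < k then \sum_v W u v else 0) - \sum_(j < n.+1 | j < k) W j u.
Proof.
move=> oW; elim: k => [|k IH] ltkn.
  by rewrite /= big_pred0 // addn0 subn0.
rewrite big_below_S //= /spend -val_eqE /= inordK // ltnS leq_eqVlt.
case: eqP => [uk | _] /=; last by rewrite IH ?(ltnW ltkn) // subnDA.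
have -> : inord k = u by apply: val_inj; rewrite /= inordK.
rewrite [X in _ - (X + _)]big1 ?ordered0 ?addn0 ?subn0 // => j ltjk.
by rewrite ordered0 // uk ltnW.
Qed.

(** Each arriving vertex adds one component and absorbs those that it
    touches. *)
Lemma card_tops n (W : 'I_n.+1 -> column n) k :
  ordered W -> k <= n.+1 ->
  #|tops k (run_rep W k)|
  + \sum_(j < n.+1 | j < k) #|run_rep W j @: supp (W j)| = k.
Proof.
move=> oW; elim: k => [|k IH] ltkn.
  rewrite big_pred0 // addn0; apply/eqP; rewrite cards_eq0.
  by apply/eqP/setP=> x; rewrite !inE.
have kE : (inord k : 'I_n.+1) = k :> nat by rewrite inordK.
have rp : reps (inord k : 'I_n.+1) (run_rep W k).
  by rewrite kE; apply: run_reps => //; apply: ltnW.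
have rj := tops_join rp (oW _); have sA := touched_tops rp (oW _).
rewrite kE in rj sA; rewrite big_below_S //= rj kE cardsU1 !inE kE ltnn andbF.
rewrite cardsDS // -[in RHS](IH (ltnW ltkn)).
by rewrite /= add1n addSn [X in (_ + X).+1 = _]addnC addnA subnK
           ?subset_leq_card.
Qed.

Lemma run_rep_edge n (W : 'I_n.+1 -> column n) (k u : 'I_n.+1) m :
  ordered W -> W k u != 0 :> nat -> k < m <= n.+1 ->
  run_rep W m u = run_rep W m k.
Proof.
move=> oW ku; elim: m => [|m IH] /andP[ltkm ltmn] //=.
rewrite ltnS leq_eqVlt in ltkm; case/orP: ltkm => [/eqP <- | ltkm]; last first.
  by rewrite /join IH // ltkm ltnW.
have rp : reps k (run_rep W k) by apply: run_reps; rewrite // ltnW.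
rewrite inord_val /join (reps_new rp (leqnn k)) setU11.
by rewrite in_setU1 imset_f ?orbT // inE.
Qed.

(** * Diagrams and matrices *)
Definition graph_of n (W : 'I_n.+1 -> column n) : weighted_graph n.+1 :=
  @WeightedGraph n.+1 {e : 'I_n.+1 * 'I_n.+1 | (W e.2 e.1 : nat) != 0}
    (fun e => (val e).1) (fun e => (val e).2) (fun e => W (val e).2 (val e).1).

(** Adding up the weights of parallel edges gives an isomorphism invariant of
    any weighted graph; a tree has no parallel edges, so nothing is lost. *)
Definition bundle d (G : weighted_graph d) k u :=
  \sum_(e : edge G | (src e == u) && (tgt e == k)) weight e.

Lemma bundle_iso d (G H : weighted_graph d) k u :
  isomorphic G H -> bundle G k u = bundle H k u.
Proof.
case=> f bf Hf; rewrite /bundle [RHS](reindex f) /=; last exact: onW_bij.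
apply: eq_big => [e | e _]; first by have [-> -> _] := Hf e.
by have [_ _ ->] := Hf e.
Qed.

Lemma bundle_graph_of n (W : 'I_n.+1 -> column n) k u :
  bundle (graph_of W) k u = W k u.
Proof.
rewrite /bundle; have [ku0 | ku] := eqVneq (W k u : nat) 0.
  rewrite big1 ?ku0 // => e /andP[/eqP eu /eqP ek].
  by move: ku0; rewrite -eu -ek.
by rewrite (big_pred1 (Sub (u, k) ku : edge (graph_of W))).
Qed.

Lemma out_bundle d (G : weighted_graph d) v :
  \sum_(e : edge G | src e == v) weight e = \sum_k bundle G k v.
Proof. exact: (partition_big (@tgt _ G) predT). Qed.

Lemma in_bundle d (G : weighted_graph d) v :
  \sum_(e : edge G | tgt e == v) weight e = \sum_u bundle G v u.
Proof.
rewrite (partition_big (@src _ G) predT) //=; apply: eq_bigr => u _.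
by apply: eq_bigl => e; rewrite andbC.
Qed.

Lemma divergence_le1 d (G : weighted_graph d) v :
  (divergence G v <= 1)%R =
  (\sum_k bundle G k v <= 1 + \sum_u bundle G v u).
Proof.
rewrite -out_bundle -in_bundle /divergence.
have sumZ (P : pred (edge G)) :
    (\sum_(e | P e) (weight e)%:Z)%R = (\sum_(e | P e) weight e)%:Z%R.
  by rewrite (big_morph Posz PoszD (erefl _)).
by rewrite !sumZ; lia.
Qed.

(** The edges that leave the set of the vertices up to [u] carry a total weight
    equal to the sum of the divergences of these vertices, which is at most
    their number. *)
Lemma bundle_le d g (G : weighted_graph d) k u :
  floor_diagram g G -> bundle G k u <= d.
Proof.
move=> [_ _ oG _ dG].
pose cut := \sum_(e : edge G | (src e <= u) && (u < tgt e)) weight e.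
apply: (@leq_trans cut).
  rewrite /bundle /cut [X in _ <= X]big_mkcond [X in X <= _]big_mkcond.
  apply: leq_sum => e _; case: ifP => // /andP[/eqP <- _].
  by rewrite leqnn oG.
have outE : \sum_(v < d | v <= u) \sum_(e : edge G | src e == v) weight e
    = \sum_(e : edge G | src e <= u) weight e.
  rewrite [RHS](partition_big (@src _ G) (fun v => v <= u)) //=.
  apply: eq_bigr => v levu; apply: eq_bigl => e.
  by symmetry; apply: andb_idl => /eqP ->.
have inE : \sum_(v < d | v <= u) \sum_(e : edge G | tgt e == v) weight e
    = \sum_(e : edge G | (src e <= u) && (tgt e <= u)) weight e.
  rewrite [RHS](partition_big (@tgt _ G) (fun v => v <= u)) //=; last first.
    by move=> e /andP[].
  apply: eq_bigr => v levu; apply: eq_bigl => e.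
  symmetry; apply: andb_idl => /eqP ev.
  by rewrite ev levu andbT (leq_trans _ levu) // -ev ltnW.
have : \sum_(e : edge G | src e <= u) weight e
    <= d + \sum_(e : edge G | (src e <= u) && (tgt e <= u)) weight e.
  rewrite -outE -inE; apply: (@leq_trans (\sum_(v < d | v <= u) 1 +
    \sum_(v < d | v <= u) \sum_(e : edge G | tgt e == v) weight e)).
    rewrite -big_split; apply: leq_sum => v _.
    by have := dG v; rewrite divergence_le1 -out_bundle -in_bundle.
  rewrite leq_add2r sum1_card -[X in _ <= X]card_ord.
  exact: max_card.
rewrite (bigID (fun e => tgt e <= u)) /= addnC leq_add2r.
by congr (_ <= _); apply: eq_bigl => e; rewrite -ltnNge.
Qed.

Lemma connect_adjacent_sym d (G : weighted_graph d) : connect_sym (adjacent G).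
Proof.
by apply: sym_connect_sym => u v; apply: eq_existsb => e; rewrite orbC.
Qed.

Lemma card_edge_graph_of n (W : 'I_n.+1 -> column n) :
  #|edge (graph_of W)| = \sum_k #|supp (W k)|.
Proof.
rewrite card_sig -sum1_card (partition_big snd predT) //=.
apply: eq_bigr => k _; rewrite (reindex_onto (pair^~ k) fst) /=.
  rewrite -sum1_card; apply: eq_bigl => u.
  by rewrite !inE !eqxx !andbT.
by case=> u k' /andP[_ /eqP <-].
Qed.

Lemma run_rep_adjacent n (W : 'I_n.+1 -> column n) (k u : 'I_n.+1) m :
  ordered W -> m <= n.+1 -> connect (adjacent (graph_of W)) u (run_rep W m u).
Proof.
move=> oW; elim: m u => [|m IH] u ltmn; first exact: connect0.
rewrite /= /join; case: ifP => [|_]; last exact/IH/ltnW.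
rewrite in_setU1 => /orP[/eqP <- | /imsetP[v vc def]]; first exact/IH/ltnW.
apply: connect_trans (IH u (ltnW ltmn)) _; rewrite def.
apply: (@connect_trans _ _ v); first by rewrite connect_adjacent_sym; apply/IH/ltnW.
rewrite inE in vc; apply/connect1/existsP.
by exists (Sub (v, inord m) vc); rewrite /= !eqxx.
Qed.

(** The edges are counted by [card_tops]: each of them makes two components
    merge, and one is left. *)
Lemma floor_graph_of n (W : 'I_n.+1 -> column n) :
  valid W -> floor_diagram 0 (graph_of W).
Proof.
move=> vW; have oW := ordered_valid vW;
case/andP: vW => /forallP aW /cards1P[r tops1].
have rp := run_reps oW (leqnn _).
have const u : run_rep W n.+1 u = r.
  apply/set1P; rewrite -tops1 inE (reps_idem rp) eqxx andbT.
  exact: ltn_ord.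
split=> [u v | | e | e | v].
- apply: (@connect_trans _ _ r); last rewrite connect_adjacent_sym.
    by rewrite -(const u); apply: run_rep_adjacent.
  by rewrite -(const v); apply: run_rep_adjacent.
- have := card_tops oW (leqnn _); rewrite tops1 cards1 add1n => -[cT].
  rewrite card_edge_graph_of addn0 subn1 /= -[RHS]cT.
  rewrite [RHS](eq_bigl xpredT) => [|j]; last by rewrite ltn_ord.
  by apply: eq_bigr => k _; have /and3P[_ _ /eqP ->] := aW k.
- by have /subsetP := oW (tgt e); move/(_ (src e)); rewrite !inE; apply; apply: (valP e).
- by rewrite lt0n; apply: (valP e).
rewrite divergence_le1.
under eq_bigr => k _ do rewrite bundle_graph_of.
under [X in _ <= 1 + X]eq_bigr => k _ do rewrite bundle_graph_of.
(* The divergence stays at most 1 at every step. *)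
suff H m : m <= n.+1 -> \sum_(j < n.+1 | j < m) W j v
    <= 1 + (if v < m then \sum_u W v u else 0).
  have := H n.+1 (leqnn _); rewrite ltn_ord; congr (_ <= _).
  by apply: eq_bigl => j; rewrite ltn_ord.
elim: m => [|m IH] ltmn; first by rewrite [X in X <= _]big_pred0.
rewrite big_below_S //.
have /and3P[/forallP/(_ v) + _ _] := aW (inord m).
rewrite inordK // run_capE ?(ltnW ltmn) // => le.
have [ltvm | lemv] := ltnP v m.
  by rewrite ltvm in le IH; rewrite ltnS (ltnW ltvm); have := IH (ltnW ltmn); lia.
have := IH (ltnW ltmn); rewrite ltnNge lemv /= addn0 => le1.
by rewrite ordered0 ?inordK // addn0 (leq_trans le1) ?leq_addr.
Qed.

(** The number of components left at the end is at least d minus the number of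
    edges of [G], with equality only if [G] has no parallel edges and if no
    vertex receives two edges from one of the components present when it
    arrives.  As [G] is connected with
    d - 1 edges, equality holds. *)
Lemma floor_columns n (G : weighted_graph n.+1) :
  floor_diagram 0 G ->
  exists2 t : n.+1.-tuple (column n),
    valid (tnth t) & isomorphic G (graph_of (tnth t)).
Proof.
move=> fG; have [cG gG oG wG dG] := fG.
pose t : n.+1.-tuple (column n) :=
  [tuple [ffun u => inord (bundle G k u)] | k < n.+1].
pose W := tnth t.
have WE k u : W k u = bundle G k u :> nat.
  by rewrite /W tnth_mktuple ffunE inordK // ltnS (bundle_le k u fG).
have We (e : edge G) : W (tgt e) (src e) != 0 :> nat.
  rewrite WE -lt0n (leq_trans (wG e)) // /bundle (bigD1 e) ?eqxx //=.
  exact: leq_addr.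
have We' k u : W k u != 0 :> nat -> exists2 e : edge G, src e = u & tgt e = k.
  rewrite WE; case: (pickP (fun e : edge G => (src e == u) && (tgt e == k))).
    by move=> e /andP[/eqP ? /eqP ?]; exists e.
  by move=> none; rewrite /bundle big_pred0.
have oW : ordered W.
  by move=> k; apply/subsetP=> u; rewrite !inE => /We'[e <- <-].
have rp := run_reps oW (leqnn _).
(* Both ends of an edge lie in one final component, hence so do all vertices. *)
have edge_rep (e : edge G) : run_rep W n.+1 (src e) = run_rep W n.+1 (tgt e).
  by apply: (run_rep_edge oW (We e)); rewrite ltn_ord leqnn.
have const u v : run_rep W n.+1 u = run_rep W n.+1 v.
  move: (run_rep W n.+1) edge_rep => p edge_rep.
  have /connectP[s] := cG u v.
  elim: s u => [|x s IH] u /=; first by move=> _ ->.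
  case/andP=> /existsP[e exu] sP sl; rewrite -(IH x sP sl).
  by case/orP: exu => /andP[/eqP <- /eqP <-].
have tops1 : #|tops n.+1 (run_rep W n.+1)| <= 1.
  apply/card_le1_eqP=> x y; rewrite !inE => /andP[_ /eqP <-] /andP[_ /eqP <-].
  exact: const.
pose h e : edge (graph_of W) := Sub (src e, tgt e) (We e).
have h_onto : [set h e | e in edge G] = setT.
  apply/setP=> e'; rewrite inE; apply/imsetP.
  by have [e se te] := We' _ _ (valP e'); exists e => //; apply: val_inj;
    rewrite /= se te -surjective_pairing.
have touch_le (k : 'I_n.+1) : #|run_rep W k @: supp (W k)| <= #|supp (W k)|.
  exact: leq_imset_card.
have := card_tops oW (leqnn _).
rewrite (eq_bigl xpredT) => [cT|j]; last by rewrite ltn_ord.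
have h_le : #|edge (graph_of W)| <= #|edge G|.
  by rewrite -cardsT -h_onto leq_imset_card.
(* At least d - 1 components are touched, at most one for each edge. *)
have [] := leqif_sum (fun (k : 'I_n.+1) (_ : true) => leqif_eq (touch_le k)).
rewrite -card_edge_graph_of => sum_le sum_eq.
have cardE : #|edge G| = #|edge (graph_of W)| by lia.
have inj (k : 'I_n.+1) : #|run_rep W k @: supp (W k)| == #|supp (W k)|.
  have : [forall (i : 'I_n.+1 | true), #|run_rep W i @: supp (W i)| == #|supp (W i)|].
    by rewrite -sum_eq; apply/eqP; lia.
  by move/forallP/(_ k).
have h_inj : injective h.
  have /imset_injP h_inj : #|[set h e | e in edge G]| == #|edge G|.
    by rewrite h_onto cardsT cardE.
  by move=> e e'; apply: h_inj.
exists t; rewrite -/W.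
  apply/andP; split; last by lia.
  apply/forallP=> k; rewrite /admissible oW inj !andbT; apply/forallP=> u.
  have [-> // | ku] := eqVneq (W k u : nat) 0.
  have ltuk : u < k by have /subsetP/(_ u) := oW k; rewrite !inE; apply.
  rewrite run_capE // ?ltuk; last exact: ltnW.
  have := dG u; rewrite divergence_le1.
  under eq_bigr => j _ do rewrite -WE.
  under [X in _ <= 1 + X]eq_bigr => j _ do rewrite -WE.
  rewrite (bigID (fun j : 'I_n.+1 => j < k)) /= [X in _ + X](bigD1 k) ?ltnn //=.
  by lia.
exists h; first by apply: inj_card_bij; rewrite ?cardE.
move=> e; split=> //=; rewrite WE /bundle (big_pred1 e) // => e'.
apply/andP/eqP => [[/eqP se /eqP te] | -> //].
by apply: h_inj; apply: val_inj; rewrite /= se te.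
Qed.

Lemma class_count_finite (T : Type) (R : T -> T -> Prop) (P : T -> Prop)
    (F : finType) (A : {set F}) (g : F -> T) :
  (forall x, x \in A -> P (g x)) ->
  (forall x y, R (g x) (g y) -> x = y) ->
  (forall y, P y -> exists2 x, x \in A & R y (g x)) ->
  class_count R P #|A|.
Proof.
move=> gP g_inj g_onto; exists (fun i : 'I_#|A| => g (enum_val i)); split.
- by move=> i; apply/gP/enum_valP.
- by move=> i j /g_inj/enum_val_inj.
- move=> y /g_onto[x xA Ryx]; exists (enum_rank_in xA x).
  by rewrite enum_rankK_in.
Qed.

Theorem theorem6p1 (d : nat) (hd : 1 <= d) :
  number_of_floor_diagrams d 0 (d ^ (d - 2)).
Proof.
case: d hd => // n _; rewrite -card_all_completions.
pose g (t : n.+1.-tuple (column n)) := graph_of (tnth t).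
apply: (class_count_finite (g := g)) => [t | t t' iso_g | G].
- by rewrite inE completesE => /floor_graph_of.
- apply: eq_from_tnth => k; apply/ffunP=> u; apply: val_inj => /=.
  by rewrite -!bundle_graph_of; apply: bundle_iso.
- by case/floor_columns => t vt; exists t; rewrite // inE completesE.
Qed.
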